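(* Let $M$ be a finite monoid in $\mathbf{DG}$, and let $k$ be a field that is a splitting field for each maximal subgroup of $M$ and whose characteristic divides the order of no maximal subgroup of $M$. Then the vertex set of $Q(kM)$ is $\coprod_{e\in E(M)}\mathrm{Irr}(G_e)$, and for $U\in\mathrm{Irr}(G_e)$, $V\in\mathrm{Irr}(G_f)$ the number of arrows from $U$ to $V$ is the multiplicity of $V\otimes_kU^*$ as an irreducible constituent of the $G_f\times G_e$-module $k[\mathrm{Irr}_{\mathscr K(M)}(e,f)]$.
   Context: $M$ finite monoid, $E(M)$ its idempotents. $M$ is rectangular if each set $\{f\in E(M): MfM=MeM\}$ is closed under multiplication; $M\in\mathbf{DG}$ if it is rectangular and $MeM=MfM$ implies $e=f$ for $e,f\in E(M)$. $G_e$ is the group of units of $eMe$; a $kG_e$-module is a $kM$-module via $m\mapsto eme$ if $e\in MmM$, and $m\mapsto 0$ otherwise. The Karoubi envelope $\mathscr K(M)$ has objects $E(M)$, morphisms $e\to f$ the elements of $fMe$, composition the multiplication of $M$, identity at $e$ equal to $e$. A morphism in a category is irreducible if it is neither a split monomorphism nor a split epimorphism, and whenever it factors as $gh$, either $h$ is a split monomorphism or $g$ is a split epimorphism; $\mathrm{Irr}_{\mathscr K(M)}(e,f)$ is the set of irreducible morphisms $e\to f$. $G_f\times G_e$ acts on it by $(g,h)m=gmh^{-1}$. $U^*$ is the contragredient; quiver has $\dim\mathrm{Ext}^1(S,T)$ arrows $S\to T$. *)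

(* Defs.v *)
From HB Require Import structures.
From mathcomp Require Import all_boot all_order all_algebra.
From mathcomp Require Import mxtens.
Set Implicit Arguments. Unset Strict Implicit. Unset Printing Implicit Defensive.
Import GRing.Theory.
Local Open Scope ring_scope.

Record fmonoid := FMonoid {
  mcar :> finType;
  mmul : mcar -> mcar -> mcar;
  mone : mcar;
  _ : associative mmul;
  _ : left_id mone mmul;
  _ : right_id mone mmul }.

Declare Scope monoid_local_scope.

Section Monoid.
Variable M : fmonoid.
Local Notation "x * y" := (mmul x y) : monoid_local_scope.
Local Open Scope monoid_local_scope.

Definition idem (e : M) : bool := e * e == e.

Definition ideal (m : M) : {set M} := [set (a * m) * b | a : M, b : M].

Definition rectangular : Prop :=
  forall e f g : M, idem e -> idem f -> idem g ->
    ideal f = ideal e -> ideal g = ideal e ->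
    idem (f * g) /\ ideal (f * g) = ideal e.

Definition inDG : Prop :=
  rectangular /\
  forall e f : M, idem e -> idem f -> ideal e = ideal f -> e = f.

(** m belongs to fMe (a morphism e -> f of the Karoubi envelope) *)
Definition corner (f e m : M) : bool := [exists x : M, m == f * (x * e)].

Definition Ge (e : M) : {set M} :=
  [set g | corner e e g &&
     [exists h : M, [&& corner e e h, g * h == e & h * g == e]]].

Definition ginv (e g : M) : M :=
  odflt e [pick h : M | [&& corner e e h, g * h == e & h * g == e]].

Definition split_mono (e f m : M) : bool :=
  [exists r : M, corner e f r && (r * m == e)].
Definition split_epi (e f m : M) : bool :=
  [exists s : M, corner e f s && (m * s == f)].

Definition irr_morph (e f m : M) : bool :=
  [&& corner f e m, ~~ split_mono e f m, ~~ split_epi e f m &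
   [forall c : M, forall g : M, forall h : M,
      [&& idem c, corner c e h, corner f c g & m == g * h] ==>
      (split_mono e c h || split_epi c f g)]].

Definition IrrK (e f : M) : {set M} := [set m | irr_morph e f m].

End Monoid.

(** Representations (left modules, on row vectors: x . v := v *m rho x,
    so a left representation satisfies rho (x y) = rho y *m rho x) *)
Section Reps.
Variable k : fieldType.
Variable T : finType.

Definition is_lrep (op : T -> T -> T) (one : T) (D : {set T}) n
    (rho : T -> 'M[k]_n) : Prop :=
  rho one = 1%:M /\
  forall x y, x \in D -> y \in D -> rho (op x y) = rho y *m rho x.

Definition stable (D : {set T}) n (rho : T -> 'M[k]_n) (U : 'M[k]_n) : Prop :=
  forall x, x \in D -> (U *m rho x <= U)%MS.

Definition irrep (D : {set T}) n (rho : T -> 'M[k]_n) : Prop :=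
  (0 < n)%N /\
  forall U : 'M[k]_n, stable D rho U -> (\rank U == 0)%N \/ row_full U.

Definition rep_iso (D : {set T}) n1 n2 (rho1 : T -> 'M[k]_n1)
    (rho2 : T -> 'M[k]_n2) : Prop :=
  exists phi : 'M[k]_(n1, n2), [/\ row_free phi, row_full phi &
    forall x, x \in D -> rho1 x *m phi = phi *m rho2 x].

Definition irr_submod (D : {set T}) n (rho : T -> 'M[k]_n) (U : 'M[k]_n) :
    Prop :=
  stable D rho U /\ ~~ (\rank U == 0)%N /\
  forall V : 'M[k]_n, stable D rho V -> (V <= U)%MS ->
    (\rank V == 0)%N \/ (V == U)%MS.

Definition submod_iso (D : {set T}) d n (rhoX : T -> 'M[k]_d)
    (rho : T -> 'M[k]_n) (U : 'M[k]_n) : Prop :=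
  exists phi : 'M[k]_(d, n), [/\ row_free phi, (phi == U)%MS &
    forall x, x \in D -> rhoX x *m phi = phi *m rho x].

(** multiplicity of the irreducible X as a constituent of W: the number of
    summands isomorphic to X in a decomposition of W as a direct sum of
    irreducible submodules (W is semisimple in our application). *)
Definition multiplicity (D : {set T}) d n (rhoX : T -> 'M[k]_d)
    (rhoW : T -> 'M[k]_n) (N : nat) : Prop :=
  exists r (W : 'I_r -> 'M[k]_n),
    [/\ forall i, irr_submod D rhoW (W i),
        (\sum_i \rank (W i))%N = n,
        (1%:M <= \sum_i W i)%MS &
        exists2 S : {set 'I_r}, #|S| = N &
          forall i, i \in S <-> submod_iso D rhoX rhoW (W i)].

End Reps.

Section MonoidReps.
Variable k : fieldType.
Variable M : fmonoid.
Local Notation "x * y" := (mmul x y) : monoid_local_scope.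
Local Open Scope monoid_local_scope.

Definition is_mrep n (rho : M -> 'M[k]_n) : Prop :=
  is_lrep (@mmul M) (mone M) [set: M] rho.

(** kG_e-modules (rho is only relevant on G_e) *)
Definition is_grep (e : M) n (rho : M -> 'M[k]_n) : Prop :=
  is_lrep (@mmul M) e (Ge e) rho.

Definition infl (e : M) n (rho : M -> 'M[k]_n) : M -> 'M[k]_n :=
  fun m => if e \in ideal m then rho (e * (m * e)) else 0.

Definition splitting_field : Prop :=
  forall (e : M) n (rho : M -> 'M[k]_n), idem e ->
    is_grep e rho -> irrep (Ge e) rho ->
    forall A : 'M[k]_n, (forall g, g \in Ge e -> A *m rho g = rho g *m A) ->
      exists c : k, A = c%:M.

Definition char_not_dvd : Prop :=
  forall e : M, idem e -> (#|Ge e|)%:R != (0 : k).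

(** dim Ext^1_{kM}(S, T), computed from extensions
    0 -> T -> E -> S -> 0, E = T (+) S with
    rho_E x = [[rho_T x, 0], [c x, rho_S x]]:
    (1-cocycles) / (coboundaries). *)
Definition cocycle_defect s t (rhoS : M -> 'M[k]_s) (rhoT : M -> 'M[k]_t)
    (c : {ffun M -> 'M[k]_(s, t)}) : {ffun M * M -> 'M[k]_(s, t)} :=
  [ffun p => c (p.1 * p.2) - (c p.2 *m rhoT p.1 + rhoS p.2 *m c p.1)].

Definition coboundary s t (rhoS : M -> 'M[k]_s) (rhoT : M -> 'M[k]_t)
    (h : 'M[k]_(s, t)) : {ffun M -> 'M[k]_(s, t)} :=
  [ffun x => rhoS x *m h - h *m rhoT x].

Definition ext1_dim s t (rhoS : M -> 'M[k]_s) (rhoT : M -> 'M[k]_t) : nat :=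
  (\dim (lker (linfun (cocycle_defect rhoS rhoT)))
   - \dim (limg (linfun (coboundary rhoS rhoT))))%N.

Definition GG (f e : M) : {set M * M} := setX (Ge f) (Ge e).

Definition tens_dual (e : M) v u (rhoV : M -> 'M[k]_v) (rhoU : M -> 'M[k]_u)
    : M * M -> 'M[k]_(v * u) :=
  fun p => rhoV p.1 *t (rhoU (ginv e p.2))^T.

Definition perm_mod (e f : M) : M * M -> 'M[k]_#|IrrK e f| :=
  fun p => \matrix_(i, j)
    ((@enum_val M (mem (IrrK e f)) j ==
      p.1 * (@enum_val M (mem (IrrK e f)) i * ginv e p.2))%:R).

End MonoidReps.

(* Main.v *)
Require Import Defs.
From HB Require Import structures.
From mathcomp Require Import all_boot all_order all_algebra.
From mathcomp Require Import mxtens.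
From mathcomp Require Import all_fingroup pgroup mxrepresentation.
From Stdlib Require Import Classical ClassicalEpsilon.
Set Implicit Arguments. Unset Strict Implicit. Unset Printing Implicit Defensive.
Import GRing.Theory.
Local Open Scope ring_scope.

(** In a monoid of DG, an idempotent e lies in MxM iff xy = yx = e for some y;
    hence such an x commutes with e, these x form a submonoid, and x |-> exe is
    multiplicative on it with values in G_e.  So inflation gives modules; if S is
    simple and e is a J-minimal idempotent not killing S, then e commutes with M
    on S, so acts as the identity, and S is inflated from G_e.

    Ext^1(S, T) is cocycles c : M -> Hom(S, T) modulo coboundaries, and
    c(x) = c(fxe) - c(f) S(x) - T(x) c(e) shows that c is controlled by fMe.
    Irreducible morphisms act by 0 on S and T, so restricting c to Irr(e, f)
    yields a G_f x G_e-equivariant function.  The kernel of this restriction is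
    the space of coboundaries (averaging over G_e when e = f), and an equivariant
    phi, extended by 0 to fMe, is the restriction of
    c(x) = phi(fxe) - phi(fe) S(x).  Hence dim Ext^1 is the dimension of
    Hom(k[Irr(e, f)], V (x) U^* ), which by Maschke and Schur is a multiplicity. *)

Local Notation "x ** y" := (mmul x y) (at level 40, left associativity).

(** * Group representations *)

Section GroupRepresentations.
Variable k : fieldType.

Lemma cent_scalar_abs_irr (gT : finGroupType) (G : {group gT}) n
    (rG : mx_representation k G n) :
  mx_irreducible rG -> (forall A, centgmx rG A -> is_scalar_mx A) ->
  mx_absolutely_irreducible rG.
Proof.
move=> irrG scal; apply: (cent_mx_scalar_abs_irr irrG).
apply: leq_trans (rank_leq_row (mxvec (1%:M : 'M[k]_n))).
apply: mxrankS; apply/memmx_subP => A; rewrite memmx_cent_envelop => /scal.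
case/is_scalar_mxP => a ->; rewrite (_ : mxvec _ = a *: mxvec 1%:M).
  exact: scalemx_sub.
by rewrite -linearZ /= scalemx1.
Qed.

(** Absolute irreducibility makes both enveloping algebras full. Expanding the two factors in group
    elements puts every [B *t C] in the algebra of [rX], and the matrix units have this shape. *)
Lemma tens_abs_irr (gT1 gT2 : finGroupType) (G1 : {group gT1})
    (G2 : {group gT2}) n1 n2 (r1 : mx_representation k G1 n1)
    (r2 : mx_representation k G2 n2)
    (rX : mx_representation k (setX_group G1 G2) (n1 * n2)) :
  mx_absolutely_irreducible r1 -> mx_absolutely_irreducible r2 ->
  {in G1 & G2, forall x y, rX (x, y) = r1 x *t (r2 y^-1%g)^T} ->
  mx_absolutely_irreducible rX.
Proof.
case/mx_abs_irrP => n1_gt0 [a aE]; case/mx_abs_irrP => n2_gt0 [b bE] rXE.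
apply/andP; split; first by rewrite muln_gt0 n1_gt0.
rewrite -sub1mx; apply/memmx_subP => A _; set E := enveloping_algebra_mx rX.
have EZ c B : (B \in E)%MS -> (c *: B \in E)%MS.
  by move=> EB; rewrite linearZ scalemx_sub.
have ES (I : finType) (P : pred I) (F : I -> 'M[k]_(n1 * n2)) :
  (forall i, P i -> (F i \in E)%MS) -> (\sum_(i | P i) F i \in E)%MS.
  by move=> EF; rewrite linear_sum summx_sub.
have tE B C : (B *t C \in E)%MS.
  rewrite [B]aE -[C]trmxK [C^T]bE.
  have -> : (\sum_(x in G1) a x B *: r1 x) *t (\sum_(y in G2) b y C^T *: r2 y)^T
     = \sum_(x in G1) \sum_(y in G2) (a x B * b y C^T) *: (r1 x *t (r2 y)^T).
    apply/matrixP => i j; case: (mxtens_indexP i) => i1 i2.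
    case: (mxtens_indexP j) => j1 j2; rewrite tensmxE mxE !summxE.
    rewrite mulr_suml; apply: eq_bigr => x _; rewrite mulr_sumr summxE.
    by apply: eq_bigr => y _; rewrite !mxE !mxtens_indexK /= mulrACA.
  apply: (ES) => x Gx; apply: (ES) => y Gy; apply: EZ.
  rewrite -[y]invgK -rXE ?groupV //; apply: envelop_mx_id.
  by rewrite inE Gx groupV.
rewrite [A]matrix_sum_delta; apply: (ES) => i _; apply: (ES) => j _; apply: EZ.
case: (mxtens_indexP i) => i1 i2; case: (mxtens_indexP j) => j1 j2.
have -> : delta_mx (mxtens_index (i1, i2)) (mxtens_index (j1, j2))
    = delta_mx i1 j1 *t delta_mx i2 j2 :> 'M[k]_(n1 * n2).
  apply/matrixP => p q; case: (mxtens_indexP p) => p1 p2.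
  case: (mxtens_indexP q) => q1 q2; rewrite tensmxE !mxE.
  rewrite !(can_eq (@mxtens_indexK _ _)) !xpair_eqE -natrM mulnb; congr (_%:R).
  by rewrite andbACA.
exact: tE.
Qed.

Lemma semisimple_of_pchar (gT : finGroupType) (G : {group gT}) n
    (rG : mx_representation k G n) :
  #|G|%:R != 0 :> k ->
  exists r (W : 'I_r -> 'M[k]_n),
    [/\ forall i, mxsimple rG (W i), (\sum_i W i :=: 1%:M)%MS &
        mxdirect (\sum_i W i)].
Proof.
move=> nzG; have pG : pgroup [pchar k]^' G by rewrite /pgroup pcharf'_nat.
(* Maschke's theorem yields semisimplicity under [classically]; once the goal is negated, that
   statement can be used at [false]. *)
apply: NNPP => nex.
have := mx_reducible_semisimple (mxmodule1 rG) (mx_Maschke_pchar rG pG).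
suff X : mxsemisimple rG 1%:M -> false by move=> /(_ false X).
case=> [I U /= simU defU dxU]; case: nex.
have bij := @enum_val_bij I.
exists #|{: I}|, (fun i => U (enum_val i)); split=> //.
  by apply: eqmx_trans defU; rewrite (reindex _ (onW_bij _ bij)).
move: dxU; rewrite !mxdirectE /= => /eqP dU; apply/eqP.
by move: dU; rewrite !(reindex _ (onW_bij _ bij)).
Qed.

(** * Multiplicity of an irreducible as the dimension of a Hom space *)

Section Multiplicity.
Variables (gT : finGroupType) (G : {group gT}) (n d : nat).
Variables (rP : mx_representation k G n) (rX : mx_representation k G d).
Variables (r : nat) (W : 'I_r -> 'M[k]_n) (H : {vspace 'M[k]_(n, d)}).
Hypothesis simW : forall i, mxsimple rP (W i).
Hypothesis defW : (\sum_i W i :=: 1%:M)%MS.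
Hypothesis dxW : mxdirect (\sum_i W i).
Hypothesis irrX : mx_irreducible rX.
Hypothesis centX : forall A, centgmx rX A -> is_scalar_mx A.
Hypothesis HP : forall F,
  F \in H <-> {in G, forall x, rP x *m F = F *m rX x}.

Definition embeds_onto (i : 'I_r) (phi : 'M[k]_(d, n)) : Prop :=
  [/\ row_free phi, (phi == W i)%MS &
      {in G, forall x, rX x *m phi = phi *m rP x}].

(** Schur's lemma: on the simple [W i] a nonzero [F] has trivial kernel, and its image is all of the
    irreducible target. The inverse of this isomorphism is the embedding. *)
Lemma Schur_hom i (F : 'M[k]_(n, d)) :
  F \in H -> W i *m F != 0 -> exists phi, embeds_onto i phi.
Proof.
move=> /HP homF nzF; have [modW nzW minW] := simW i.
have modK : mxmodule rP (W i :&: kermx F)%MS.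
  apply/mxmoduleP => x Gx; rewrite sub_capmx.
  rewrite (submx_trans _ (mxmoduleP modW x Gx)) ?submxMr ?capmxSl //=.
  apply/sub_kermxP; rewrite -mulmxA homF // mulmxA.
  by rewrite (sub_kermxP (capmxSr _ _)) mul0mx.
have K0 : (W i :&: kermx F)%MS = 0.
  apply/eqP; apply: contraNT nzF => nzK; apply/eqP/sub_kermxP.
  exact: submx_trans (minW _ modK (capmxSl _ _) nzK) (capmxSr _ _).
have fullF : row_full (W i *m F).
  suff: row_full <<W i *m F>>%MS by rewrite -!sub1mx genmxE.
  case/mx_irrP: irrX => _; apply; last by rewrite -mxrank_eq0 genmxE mxrank_eq0.
  apply/mxmoduleP => x Gx; rewrite genmxE (eqmxMr _ (genmxE _)) -mulmxA -homF //.
  by rewrite mulmxA submxMr // (mxmoduleP modW).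
have [B BE] := row_fullP fullF.
have phiF : (B *m W i) *m F = 1%:M by rewrite -mulmxA.
have injF (A : 'M[k]_(d, n)) : (A <= W i)%MS -> A *m F = 0 -> A = 0.
  move=> AW /sub_kermxP AF; apply/eqP.
  by rewrite -submx0 -K0 sub_capmx AW.
exists (B *m W i); split.
- by apply/row_freeP; exists F.
- rewrite submxMl /=; apply/rV_subP => w wW.
  have -> : w = (w *m F) *m (B *m W i); last exact: submxMl.
  apply/eqP; rewrite -subr_eq0 -submx0 -K0 sub_capmx.
  rewrite addmx_sub ?eqmx_opp //; last by rewrite mulmxA submxMl.
  by apply/sub_kermxP; rewrite mulmxBl -[_ *m _ *m F]mulmxA phiF mulmx1 subrr.
- move=> x Gx; apply/eqP; rewrite -subr_eq0; apply/eqP/injF.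
    rewrite addmx_sub ?eqmx_opp //; first by rewrite mulmxA submxMl.
    by rewrite -mulmxA mulmx_sub // (mxmoduleP modW).
  by rewrite mulmxBl -!mulmxA homF // !mulmxA phiF -!mulmxA (mulmxA B) phiF
     ?mulmx1 ?mul1mx subrr.
Qed.

Let cW i : 'M[k]_n := (\sum_(j | j != i) W j)%MS.

Let cap_cW i : (W i :&: cW i)%MS = 0.
Proof. by move/mxdirect_sumsP: dxW => /(_ i isT). Qed.

Let pr i := proj_mx (W i) (cW i).

Let modW i : mxmodule rP (W i).
Proof. by case: (simW i). Qed.

(** The projection is equivariant because [W i] and its complement [cW i] are both submodules. *)
Let prG i x : x \in G -> rP x *m pr i = pr i *m rP x.
Proof.
move=> Gx; have mod_cW : mxmodule rP (cW i) by apply: sumsmx_module.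
have sub1 : (1%:M <= W i + cW i)%MS by rewrite -defW (bigD1 i).
have h1 : pr i *m rP x *m pr i = pr i *m rP x.
  rewrite proj_mx_id //; apply: submx_trans (mxmoduleP (modW i) x Gx).
  by rewrite submxMr // -[pr i]mul1mx proj_mx_sub.
have : (1%:M - pr i) *m rP x *m pr i = 0.
  rewrite proj_mx_0 //; apply: submx_trans (mxmoduleP mod_cW x Gx).
  by rewrite submxMr // -[pr i]mul1mx proj_mx_compl_sub.
by rewrite !mulmxBl mul1mx h1 => /eqP; rewrite subr_eq0 => /eqP.
Qed.

(** The maps [psi i], projection to [W i] followed by the inverse of [phi i], form a basis of [H]
    indexed by [S]. They are independent, being dual to the [phi i]. They span because each
    [phi i *m F] is scalar and, by [Schur_hom], [F] kills the remaining summands. *)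
Lemma dim_hom (S : {set 'I_r}) :
  (forall i, i \in S <-> exists phi, embeds_onto i phi) -> \dim H = #|S|.
Proof.
move=> defS; have [d0 _] := (mx_irrP rX).1 irrX.
pose phi i := epsilon (inhabits 0) (embeds_onto i).
have phiP i : i \in S -> embeds_onto i (phi i).
  by move=> /defS; apply: epsilon_spec.
pose psi i := pr i *m pinvmx (phi i).
have phipsi i j : i \in S -> j \in S -> phi i *m psi j = (i == j)%:R%:M.
  move=> /phiP[fi /eqmxP Wi _] Sj; rewrite mulmxA.
  have [<-|ij] := eqVneq i j.
    by rewrite proj_mx_id ?Wi // -{1}[phi i]mul1mx mulmxKp.
  by rewrite proj_mx_0 ?mul0mx ?raddf0 // Wi (sumsmx_sup i).
have psiH i : i \in S -> psi i \in H.
  move=> /phiP[fi /eqmxP Wi Xi]; apply/HP => x Gx.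
  have e : pr i *m rP x = psi i *m rX x *m phi i.
    by rewrite -mulmxA Xi // mulmxA mulmxKpV // Wi -[pr i]mul1mx proj_mx_sub.
  by rewrite mulmxA prG // e mulmxKp.
pose g (x : 'rV[k]_#|S|) : 'M[k]_(n, d) := \sum_a x 0 a *: psi (enum_val a).
have lin_g : linear g.
  move=> c x y; rewrite /g scaler_sumr -big_split; apply: eq_bigr => a _ /=.
  by rewrite !mxE scalerDl scalerA.
pose gL : {linear 'rV[k]_#|S| -> 'M[k]_(n, d)} := HB.pack g
  (GRing.isLinear.Build _ _ _ _ g lin_g).
have phig a x : phi (enum_val a) *m g x = (x 0 a)%:M.
  rewrite mulmx_sumr (bigD1 a) //= big1 => [|b ab].
    by rewrite addr0 -scalemxAr phipsi ?enum_valP // eqxx scalemx1.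
  rewrite -scalemxAr phipsi ?enum_valP // (inj_eq enum_val_inj) eq_sym (negPf ab).
  by rewrite raddf0 scaler0.
have defH : H = (linfun gL @: fullv)%VS.
  apply/vspaceP => F; apply/idP/memv_imgP => [HF|[x _ ->]]; last first.
    by rewrite lfunE /= memv_suml // => a _; rewrite memvZ // psiH ?enum_valP.
  (* Each product is a scalar matrix, so any diagonal entry gives the coordinate; [d0] provides an
     index. *)
  pose x : 'rV[k]_#|S| := \row_a (phi (enum_val a) *m F) (Ordinal d0) (Ordinal d0).
  exists x; first exact: memvf.
  rewrite lfunE /=; apply/eqP; rewrite -subr_eq0 -[_ - _]mul1mx; apply/eqP/sub_kermxP.
  have HD : F - g x \in H.
    by rewrite memvB ?memv_suml // => a _; rewrite memvZ // psiH ?enum_valP.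
  rewrite -defW; apply/sumsmx_subP => i _; apply/sub_kermxP.
  apply: NNPP => /eqP nzi.
  have Si : i \in S by apply/defS; exact: Schur_hom nzi.
  move/eqP: nzi; apply; have [_ /eqmxP Wi Xi] := phiP i Si.
  apply/sub_kermxP; rewrite -Wi; apply/sub_kermxP.
  have /is_scalar_mxP[c Fc] : is_scalar_mx (phi i *m F).
    apply: centX; apply/centgmxP => y Gy.
    by rewrite -mulmxA -(HP F).1 // !mulmxA Xi.
  rewrite -(enum_rankK_in Si Si) mulmxBr phig mxE enum_rankK_in // Fc.
  by rewrite mxE eqxx subrr.
have <- : \dim (fullv : {vspace 'rV[k]_#|S|}) = #|S|.
  by rewrite dimvf; apply: mul1n.
rewrite defH -(limg_ker_dim (linfun gL) fullv).
rewrite (_ : lker _ = 0%VS) ?capv0 ?dimv0 //.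
apply/eqP/lker0P => x y; rewrite !lfunE /= => xy; apply/rowP => a.
have := congr1 (mulmx (phi (enum_val a))) xy.
by rewrite !phig => /matrixP/(_ (Ordinal d0) (Ordinal d0)); rewrite !mxE eqxx.
Qed.

End Multiplicity.
End GroupRepresentations.

(** * Monoids in DG *)

Section Monoid.
Variable M : fmonoid.
Implicit Types a b e f g h m x y : M.

Lemma mmulA : associative (@mmul M). Proof. by case: M. Qed.
Lemma mmul1 : left_id (mone M) (@mmul M). Proof. by case: M. Qed.
Lemma mmulm1 : right_id (mone M) (@mmul M). Proof. by case: M. Qed.

Lemma idemP e : idem e -> e ** e = e. Proof. by move/eqP. Qed.

Lemma idem1 : idem (mone M). Proof. by apply/eqP; rewrite mmul1. Qed.

Lemma in_idealP x m : reflect (exists a b, x = a ** m ** b) (x \in ideal m).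
Proof.
apply: (iffP imset2P) => [[a b _ _ ->]|[a [b ->]]]; first by exists a, b.
by exists a b.
Qed.

Lemma ideal_refl m : m \in ideal m.
Proof. by apply/in_idealP; exists (mone M), (mone M); rewrite mmul1 mmulm1. Qed.

Lemma ideal_one x : x \in ideal (mone M).
Proof. by apply/in_idealP; exists x, (mone M); rewrite !mmulm1. Qed.

Lemma ideal_trans y x z : x \in ideal y -> y \in ideal z -> x \in ideal z.
Proof.
move=> /in_idealP[a [b ->]] /in_idealP[c [d ->]]; apply/in_idealP.
by exists (a ** c), (d ** b); rewrite !mmulA.
Qed.

Lemma ideal_mulr x y : x ** y \in ideal x.
Proof. by apply/in_idealP; exists (mone M), y; rewrite mmul1. Qed.

Lemma ideal_mull x y : x ** y \in ideal y.
Proof. by apply/in_idealP; exists x, (mone M); rewrite mmulm1. Qed.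

Lemma eq_idealP x y : x \in ideal y -> y \in ideal x -> ideal x = ideal y.
Proof.
by move=> xy yx; apply/setP => z; apply/idP/idP => /ideal_trans; apply.
Qed.

Lemma cornerP f e m : idem e -> idem f ->
  reflect (f ** m = m /\ m ** e = m) (corner f e m).
Proof.
move=> /idemP ee /idemP ff; apply: (iffP existsP) => [[x /eqP ->]|[fm me]].
  by rewrite !mmulA ff -!mmulA ee.
by exists m; rewrite me fm.
Qed.

Fixpoint mexp x n := if n is p.+1 then x ** mexp x p else mone M.

Lemma mexpD x p q : mexp x (p + q) = mexp x p ** mexp x q.
Proof. by elim: p => [|p IH] /=; rewrite ?mmul1 // IH mmulA. Qed.

Lemma idem_power x : exists n, idem (mexp x n.+1).
Proof.
have [i [p [p0 Ep]]] : exists i p, (0 < p)%N /\ mexp x i = mexp x (i + p).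
  have ninj : ~ injective (fun i : 'I_#|M|.+1 => mexp x i).
    by move=> /leq_card; rewrite card_ord ltnn.
  apply: NNPP => H; apply: ninj => i j /= eqij; apply: val_inj => /=.
  have [ij|ji|//] := ltngtP i j; case: H.
    by exists i, (j - i)%N; rewrite subn_gt0 ij subnKC // ltnW.
  by exists j, (i - j)%N; rewrite subn_gt0 ji subnKC // ltnW.
have E1 l : (i <= l)%N -> mexp x (l + p) = mexp x l.
  by move=> /subnK <-; rewrite -addnA !mexpD -mexpD -Ep.
have E2 q l : (i <= l)%N -> mexp x (l + q * p) = mexp x l.
  elim: q l => [|q IH] l il; first by rewrite addn0.
  by rewrite mulSn addnA IH ?E1 // (leq_trans il) ?leq_addr.
(* The exponent [i.+1 * p] is positive, a multiple of the period [p] and at least the preperiod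
   [i]. *)
exists (i.+1 * p).-1; have gt0 : (0 < i.+1 * p)%N by rewrite muln_gt0.
by rewrite prednK //; apply/eqP; rewrite -mexpD E2 // (leq_trans (leqnSn i)) ?leq_pmulr.
Qed.

Lemma ginvP e g : g \in Ge e ->
  [/\ corner e e (ginv e g), g ** ginv e g = e & ginv e g ** g = e].
Proof.
rewrite inE => /andP[_ /existsP[h /and3P[h1 h2 h3]]]; rewrite /ginv.
by case: pickP => [y /and3P[? /eqP ? /eqP ?]|/(_ h)] //=; rewrite h1 h2 h3.
Qed.

(** * Ideals, maximal subgroups and irreducible morphisms in DG *)

Section DG.
Hypothesis DG : inDG M.

(** Write [e] as [a1 ** x ** b1] with [e] absorbed into both outer factors. Then [x ** b1 ** a1] and
    [b1 ** a1 ** x] are idempotents generating the ideal of [e], so both equal [e]. *)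
Lemma idealP e x : idem e ->
  reflect (exists y, x ** y = e /\ y ** x = e) (e \in ideal x).
Proof.
move=> ie; have ee := idemP ie.
apply: (iffP idP) => [|[y [<- _]]]; last exact: ideal_mulr.
move=> /in_idealP[a [b eE]]; pose b1 := b ** e; pose a1 := e ** a.
have e1 : a1 ** x ** b1 = e.
  by rewrite /a1 /b1 !mmulA -[e ** a ** x]mmulA -[e ** _ ** b]mmulA -eE ee ee.
have b1e : b1 ** e = b1 by rewrite /b1 -mmulA ee.
have ea1 : e ** a1 = a1 by rewrite /a1 mmulA ee.
move: a1 b1 e1 b1e ea1 {eE} => a1 b1 e1 b1e ea1.
have uniq z : z ** z = z -> z \in ideal e -> e \in ideal z -> z = e.
  by move=> /eqP iz h1 h2; apply: DG.2 => //; apply: eq_idealP.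
exists (b1 ** a1); split; apply: uniq.
- by rewrite !mmulA -(mmulA (x ** b1)) -(mmulA (x ** b1)) e1 -(mmulA x) b1e.
- by apply/in_idealP; exists (x ** b1), a1; rewrite -(mmulA x) b1e mmulA.
- apply/in_idealP; exists a1, (x ** b1).
  by rewrite !mmulA e1 ea1 e1.
- by rewrite !mmulA -(mmulA b1) -(mmulA b1) e1 b1e !mmulA.
- by apply/in_idealP; exists b1, (a1 ** x); rewrite b1e mmulA.
- apply/in_idealP; exists (a1 ** x), b1.
  by rewrite !mmulA e1 ea1 e1.
Qed.

Lemma ideal_comm e x : idem e -> e \in ideal x -> x ** e = e ** x.
Proof. by move=> ie /(idealP _ ie)[y [xy yx]]; rewrite -{1}yx mmulA xy. Qed.

(** With [p] and [q] inverting [x] and [y] up to [e], the product [x ** y ** q ** p] collapses to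
    [e], since [e] commutes with [x]. This multiplicativity is what makes inflation a
    representation. *)
Lemma ideal_mul e x y : idem e ->
  (e \in ideal (x ** y)) = (e \in ideal x) && (e \in ideal y).
Proof.
move=> ie; apply/idP/andP => [exy|[ex ey]].
  by split; apply: ideal_trans exy _; rewrite ?ideal_mulr ?ideal_mull.
have xe := ideal_comm ie ex; have ye := ideal_comm ie ey.
move/(idealP _ ie): ex => [p [xp px]]; move/(idealP _ ie): ey => [q [yq qy]].
apply/in_idealP; exists (mone M), (q ** p).
by rewrite mmul1 !mmulA -(mmulA x) yq xe -mmulA xp idemP.
Qed.

Lemma GeP e g : idem e ->
  reflect [/\ e ** g = g, g ** e = g & e \in ideal g] (g \in Ge e).
Proof.
move=> ie; rewrite inE; apply: (iffP andP) => [[/(cornerP _ ie ie)[eg ge]]|].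
  by move=> /existsP[h /and3P[_ /eqP gh _]]; split=> //; rewrite -{1}gh ideal_mulr.
case=> eg ge /(idealP _ ie)[y [gy yg]]; split; first exact/cornerP.
apply/existsP; exists (e ** y ** e); apply/and3P; split.
- apply/cornerP => //; split; first by rewrite !mmulA idemP.
  by rewrite -mmulA idemP.
- by rewrite !mmulA ge gy idemP.
- by rewrite -!mmulA eg yg idemP.
Qed.

Lemma Ge_corner e x : idem e -> e \in ideal x -> e ** (x ** e) \in Ge e.
Proof.
move=> ie ex; apply/GeP => //; split; first by rewrite mmulA idemP.
  by rewrite -!mmulA idemP.
by rewrite !ideal_mul // ideal_refl ex.
Qed.

Lemma Ge1 e : idem e -> e \in Ge e.
Proof. by move=> ie; apply/GeP; rewrite ?idemP ?ideal_refl. Qed.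

Lemma GeM e g h : idem e -> g \in Ge e -> h \in Ge e -> g ** h \in Ge e.
Proof.
move=> ie /(GeP _ ie)[eg ge gJ] /(GeP _ ie)[eh he hJ]; apply/GeP => //.
by rewrite mmulA eg -mmulA he ideal_mul // gJ.
Qed.

Lemma GeV e g : idem e -> g \in Ge e -> ginv e g \in Ge e.
Proof.
move=> ie /ginvP[/(cornerP _ ie ie)[h1 h2] h3 h4]; apply/GeP => //; split=> //.
by rewrite -{1}h3 ideal_mull.
Qed.

Lemma ginvE e g h : idem e -> g \in Ge e -> h \in Ge e -> g ** h = e -> ginv e g = h.
Proof.
move=> ie Gg /(GeP _ ie)[eh _ _] gh; have [/(cornerP _ ie ie)[_ he] h1 h2] := ginvP Gg.
by rewrite -he -[X in _ ** X]gh mmulA h2.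
Qed.

Lemma ginv_id e : idem e -> ginv e e = e.
Proof. by move=> ie; apply: ginvE; rewrite ?Ge1 ?idemP. Qed.

Lemma ginvM e g h : idem e -> g \in Ge e -> h \in Ge e ->
  ginv e (g ** h) = ginv e h ** ginv e g.
Proof.
move=> ie Gg Gh; apply: ginvE; rewrite ?GeM ?GeV //.
have [_ gg' _] := ginvP Gg; have [_ hh' _] := ginvP Gh.
by case/(GeP _ ie): Gg => _ ge _; rewrite mmulA -(mmulA g) hh' ge.
Qed.

(** By [idealP] one-sided and two-sided invertibility relative to [e] coincide, so splitting becomes
    a condition on ideals. *)
Lemma split_monoP e f m : idem e -> f ** m = m -> split_mono e f m = (e \in ideal m).
Proof.
move=> ie fm; apply/existsP/idealP => // [[r /andP[_ /eqP rm]]|[y [my ym]]].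
  by apply/(idealP _ ie); rewrite -[X in X \in _]rm ideal_mull.
exists (e ** (y ** f)); apply/andP; split.
  by apply/existsP; exists y.
by rewrite -!mmulA fm ym idemP.
Qed.

Lemma split_epiP e f m : idem f -> m ** e = m -> split_epi e f m = (f \in ideal m).
Proof.
move=> ie fm; apply/existsP/idealP => // [[r /andP[_ /eqP rm]]|[y [my ym]]].
  by apply/(idealP _ ie); rewrite -[X in X \in _]rm ideal_mulr.
exists (e ** (y ** f)); apply/andP; split.
  by apply/existsP; exists y.
by rewrite !mmulA fm my idemP.
Qed.

(** Whether e lies in MyM does not change when y is replaced by y ** e, and
    likewise for f and f ** x: only factorizations through the object 1 matter. *)
Lemma irrP e f m : idem e -> idem f ->
  reflect [/\ f ** m = m, m ** e = m, e \notin ideal m, f \notin ideal m &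
           forall x y, m = x ** y -> e \in ideal y \/ f \in ideal x]
   (m \in IrrK e f).
Proof.
move=> ie jf; rewrite inE; apply: (iffP and4P) => [[/(cornerP _ ie jf)[fm me]]|].
  rewrite split_monoP // split_epiP // => h1 h2 irr; split=> // x y mE.
  move/forallP: irr => /(_ (mone M))/forallP/(_ (f ** x))/forallP/(_ (y ** e)).
  rewrite idem1 /= split_monoP ?mmul1 // split_epiP ?mmulm1 // !ideal_mul //.
  rewrite !ideal_refl andbT /= => /implyP H; apply/orP/H; apply/and3P; split.
  - by apply/cornerP; rewrite ?idem1 // mmul1 -mmulA idemP.
  - by apply/cornerP; rewrite ?idem1 // mmulm1 mmulA idemP.
  - by rewrite -mmulA (mmulA x) -mE me fm.
case=> fm me h1 h2 irr; rewrite split_monoP // split_epiP //; split=> //.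
  exact/cornerP.
apply/forallP => c; apply/forallP => x; apply/forallP => y; apply/implyP.
case/and4P => ic /(cornerP _ ie ic)[cy _] /(cornerP _ ic jf)[_ xc] /eqP /irr.
by rewrite split_monoP // split_epiP // => /orP.
Qed.

Lemma reducibleP e f m : idem e -> idem f -> m \notin IrrK e f ->
  f ** m = m -> m ** e = m -> e \notin ideal m -> f \notin ideal m ->
  exists x y, [/\ m = x ** y, e \notin ideal y & f \notin ideal x].
Proof.
move=> ie jf nirr fm me h1 h2; apply: NNPP => H; case/(irrP _ ie jf): nirr.
split=> // x y mE; case: (boolP (e \in ideal y)) => ey; first by left.
case: (boolP (f \in ideal x)) => fx; first by right.
by case: H; exists x, y.
Qed.

(** A factorization of the translate becomes one of [m] after moving the inverse units into the
    outer factors; by [ideal_mul] the conclusion for the moved factors passes to the original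
    ones. *)
Lemma Irr_act e f g h m : idem e -> idem f -> g \in Ge f -> h \in Ge e ->
  m \in IrrK e f -> g ** (m ** h) \in IrrK e f.
Proof.
move=> ie jf Gg Gh /(irrP _ ie jf)[fm me h1 h2 irr].
have [fg gf _] := GeP _ jf Gg; have [eh he _] := GeP _ ie Gh.
have [_ _ g'g] := ginvP Gg; have [_ hh' _] := ginvP Gh.
apply/(irrP _ ie jf); split.
- by rewrite mmulA fg.
- by rewrite -!mmulA he.
- by rewrite !ideal_mul // (negPf h1) andbF.
- by rewrite !ideal_mul // (negPf h2) andbF.
move=> x y mE; have := irr (ginv f g ** x) (y ** ginv e h).
rewrite !ideal_mul //; case=> [|/andP[]|/andP[]]; [|by left|by right].
by rewrite -mmulA (mmulA x) -mE -!mmulA hh' me (mmulA (ginv f g)) g'g.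
Qed.

End DG.
End Monoid.

(** * Simple modules *)

Section Simples.
Variables (M : fmonoid) (k : fieldType).
Hypothesis DG : inDG M.
Implicit Types e f g h m x y : M.

Section Inflation.
Variables (e : M) (n : nat) (rho : M -> 'M[k]_n).
Hypothesis ie : idem e.

Lemma infl0 x : e \notin ideal x -> infl e rho x = 0.
Proof. by rewrite /infl => /negPf->. Qed.

Lemma infl_Ge g : g \in Ge e -> infl e rho g = rho g.
Proof. by case/(GeP DG _ ie) => eg ge gJ; rewrite /infl gJ ge eg. Qed.

Hypothesis rep : is_grep e rho.

Lemma infl_one x : e \in ideal x -> e ** x = e -> infl e rho x = 1%:M.
Proof. by move=> ex xe; rewrite /infl ex mmulA xe idemP // rep.1. Qed.

Lemma infl_id : infl e rho e = 1%:M.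
Proof. by apply: infl_one; rewrite ?ideal_refl ?idemP. Qed.

Lemma infl_mul x y : infl e rho (x ** y) = infl e rho y *m infl e rho x.
Proof.
have abs z : e \in ideal z -> e ** (z ** e) = z ** e.
  by move=> /(ideal_comm DG ie)->; rewrite mmulA idemP.
rewrite /infl ideal_mul //; case: ifP => [/andP[ex ey]|]; last first.
  by case: (e \in ideal x) => /= [->|_]; rewrite ?mul0mx ?mulmx0.
rewrite ex ey -rep.2 ?Ge_corner // !abs ?ideal_mul ?ex //; congr (rho _).
by rewrite -[RHS]mmulA (mmulA e y) -(ideal_comm DG ie ey) -(mmulA y) idemP // mmulA.
Qed.

Lemma infl_mrep : is_mrep (infl e rho).
Proof.
split; last by move=> x y _ _; apply: infl_mul.
by apply: infl_one; rewrite ?ideal_one ?mmulm1.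
Qed.

Lemma infl_irrep : irrep (Ge e) rho -> irrep [set: M] (infl e rho).
Proof.
case=> n0 irr; split=> // U stU; apply: irr => g Gg.
by rewrite -infl_Ge // stU ?inE.
Qed.

End Inflation.

(** * Every simple module is an inflation *)

Section SimpleIsInflation.
Variables (n : nat) (rho : M -> 'M[k]_n).
Hypotheses (rep : is_mrep rho) (irr : irrep [set: M] rho).

Let rhoM x y : rho (x ** y) = rho y *m rho x.
Proof. by apply: rep.2; rewrite inE. Qed.

Let rho_ideal x y : x \in ideal y -> rho x != 0 -> rho y != 0.
Proof.
move=> /in_idealP[a [b ->]]; rewrite !rhoM; apply: contra_neq => ->.
by rewrite mul0mx mulmx0.
Qed.

Lemma apex_exists : exists e, [/\ idem e, rho e != 0 &
  forall x, x \in ideal e -> rho x != 0 -> e \in ideal x].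
Proof.
have [n0 irrU] := irr.
have rho1 : rho (mone M) != 0.
  by rewrite rep.1 -mxrank_eq0 mxrank1 -lt0n.
(* Minimizing the size of the ideal selects a J-minimal element that does not act as zero. *)
case: (@arg_minnP _ (mone M) (fun x => rho x != 0) (fun x => #|ideal x|) rho1) => x nzx minx.
have {}minx y : y \in ideal x -> rho y != 0 -> x \in ideal y.
  move=> yx nzy; have sub : ideal y \subset ideal x.
    by apply/subsetP => z /ideal_trans; apply.
  suff /eqP eqi : ideal y == ideal x by rewrite eqi ideal_refl.
  by rewrite eqEcard sub minx.
(* The submodule generated by the images of all elements of the ideal is nonzero, hence everything.
   Thus [x] cannot kill all these images, which gives some [y] in the ideal with [x ** y] acting
   nontrivially. *)
pose U : 'M[k]_n := (\sum_(y in ideal x) rho y)%MS.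
have fullU : row_full U.
  have stU : stable [set: M] rho U.
    move=> z _; rewrite sumsmxMr; apply/sumsmx_subP => y yx.
    by rewrite -rhoM (sumsmx_sup (z ** y)) // (ideal_trans (ideal_mull z y)).
  case: (irrU U stU) => //; rewrite mxrank_eq0 => /eqP U0; case/eqP: nzx.
  apply/eqP; rewrite -submx0 -U0; apply: sumsmx_sup (submx_refl _).
  exact: ideal_refl.
have [y yx nzxy] : exists2 y, y \in ideal x & rho (x ** y) != 0.
  apply: NNPP => H; case/eqP: nzx; rewrite -[rho x]mul1mx.
  apply/sub_kermxP; apply: submx_trans (_ : U <= _)%MS; first by rewrite sub1mx.
  apply/sumsmx_subP => y yx; apply/sub_kermxP; rewrite -rhoM.
  by apply: NNPP => /eqP nz; case: H; exists y.
have /in_idealP[a [b xE]] := minx _ (ideal_trans (ideal_mulr x y) (ideal_refl x)) nzxy.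
have {}xE : x = a ** x ** (y ** b) by rewrite {1}xE !mmulA.
(* Iterating [x = a ** x ** (y ** b)] shows that [x] lies in the ideal of every power of [y ** b],
   in particular of an idempotent one. *)
have iter p : x = mexp a p ** x ** mexp (y ** b) p.
  elim: p => [|p IH]; first by rewrite /= mmulm1 mmul1.
  have -> : mexp a p.+1 = mexp a p ** a by rewrite -addn1 mexpD /= mmulm1.
  by rewrite /= {1}IH {1}xE !mmulA.
have [p ip] := idem_power (y ** b); exists (mexp (y ** b) p.+1).
have ex : mexp (y ** b) p.+1 \in ideal x.
  by rewrite /= -mmulA (ideal_trans (ideal_mulr _ _)).
have xe : x \in ideal (mexp (y ** b) p.+1).
  by rewrite {1}(iter p.+1) ideal_mull.
split=> //; first exact: rho_ideal xe nzx.
by move=> z zx nzz; rewrite (ideal_trans ex) // minx // (ideal_trans zx).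
Qed.

(** The same [rho] serves on the maximal subgroup. Once [rho e] is the identity, [rho] agrees at [x]
    and [e ** (x ** e)], and vanishes at [x] when [e] is outside the ideal of [x]. *)
Lemma simple_is_inflation : exists e, [/\ idem e, rho =1 infl e rho,
  is_grep e rho & irrep (Ge e) rho].
Proof.
have [e [ie nze mine]] := apex_exists; exists e.
have [n0 irrU] := irr.
have out x : e \notin ideal x -> rho (x ** e) = 0 /\ rho (e ** x) = 0.
  move=> ex; split; apply: NNPP => /eqP nz; case/negP: ex.
    by apply: ideal_trans (mine _ (ideal_mull x e) nz) (ideal_mulr _ _).
  by apply: ideal_trans (mine _ (ideal_mulr e x) nz) (ideal_mull _ _).
have comm x : rho (x ** e) = rho (e ** x).
  case: (boolP (e \in ideal x)) => [/(ideal_comm DG ie)-> //|/out[-> ->] //].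
(* Since [rho e] commutes with the action, its image is a nonzero submodule, hence everything; an
   idempotent of full rank is the identity. *)
have rhoe : rho e = 1%:M.
  have full : row_full (rho e).
    have st : stable [set: M] rho (rho e).
      by move=> x _; rewrite -rhoM comm rhoM submxMl.
    by case: (irrU _ st) => //; rewrite mxrank_eq0 (negPf nze).
  have /row_fullP[B Be] := full.
  by rewrite -[rho e]mul1mx -{1}Be -mulmxA -rhoM idemP.
have rhoE x : rho x = infl e rho x.
  rewrite /infl; case: ifP => [_|/negbT/out[xe _]].
    by rewrite !rhoM rhoe mulmx1 mul1mx.
  by rewrite -[rho x]mul1mx -rhoe -rhoM xe.
split=> //; split=> //.
move=> U stU; apply: irrU => x _; rewrite rhoE /infl.
by case: ifP => [ex|_]; rewrite ?mulmx0 ?sub0mx // stU // Ge_corner.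
Qed.

End SimpleIsInflation.

(** Evaluating the intertwining relation at [e] and at [f] forces each to lie in the ideal of the
    other, as otherwise [phi] would vanish; DG then gives [e = f]. *)
Lemma infl_iso e f n1 n2 (rho1 : M -> 'M[k]_n1) (rho2 : M -> 'M[k]_n2) :
  idem e -> is_grep e rho1 -> irrep (Ge e) rho1 ->
  idem f -> is_grep f rho2 -> irrep (Ge f) rho2 ->
  (rep_iso [set: M] (infl e rho1) (infl f rho2) <->
   e = f /\ rep_iso (Ge e) rho1 rho2).
Proof.
move=> ie rep1 [n10 irr1] jf rep2 [n20 irr2]; split=> [[phi [free full com]]|].
  have nz : phi != 0.
    by move: free; rewrite /row_free -mxrank_eq0 => /eqP->; rewrite -lt0n.
  have fe : f \in ideal e.
    apply: contraNT nz => fe; have := com e (in_setT e).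
    by rewrite infl_id // (infl0 _ fe) mulmx0 mul1mx => ->.
  have ef : e \in ideal f.
    apply: contraNT nz => ef; have := com f (in_setT f).
    by rewrite [X in _ = _ *m X]infl_id // (infl0 _ ef) mul0mx mulmx1 => <-.
  have eqf : e = f by apply: DG.2 => //; apply: eq_idealP.
  split=> //; exists phi; split=> // g Gg; have := com g (in_setT g).
  by rewrite infl_Ge // infl_Ge // -eqf.
case=> eqf [phi [free full com]]; exists phi; split=> // x _; rewrite -eqf /infl.
case: ifP => ex; last by rewrite mul0mx mulmx0.
by rewrite com // Ge_corner.
Qed.

End Simples.

(** * Cocycles and irreducible morphisms *)

Section Cocycles.
Variables (M : fmonoid) (k : fieldType) (e f : M) (u v : nat).
Variables (rhoU : M -> 'M[k]_u) (rhoV : M -> 'M[k]_v).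
Hypotheses (DG : inDG M) (ie : idem e) (jf : idem f).
Hypotheses (repU : is_grep e rhoU) (repV : is_grep f rhoV).
Implicit Types g h m x y : M.

Local Notation S := (infl e rhoU).
Local Notation T := (infl f rhoV).

(** The condition on the lower left block of an extension of [S] by [T]; the order of factors is
    reversed because matrices act on row vectors. *)
Definition cocycle (c : M -> 'M[k]_(u, v)) : Prop :=
  forall x y, c (x ** y) = c y *m T x + S y *m c x.

Let Se : S e = 1%:M. Proof. exact: infl_id. Qed.
Let Tf : T f = 1%:M. Proof. exact: infl_id. Qed.
Let S0 x : e \notin ideal x -> S x = 0. Proof. exact: infl0. Qed.
Let T0 x : f \notin ideal x -> T x = 0. Proof. exact: infl0. Qed.
Let SM x y : S (x ** y) = S y *m S x. Proof. exact: infl_mul. Qed.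
Let TM x y : T (x ** y) = T y *m T x. Proof. exact: infl_mul. Qed.

Lemma coboundary_cocycle (h : 'M[k]_(u, v)) :
  cocycle (fun x => S x *m h - h *m T x).
Proof.
move=> x y; rewrite SM TM mulmxBl mulmxBr !mulmxA.
by rewrite [RHS]addrC addrA subrK.
Qed.

Lemma cocycleB c1 c2 : cocycle c1 -> cocycle c2 -> cocycle (fun x => c1 x - c2 x).
Proof.
move=> h1 h2 x y; rewrite h1 h2 mulmxBl mulmxBr opprD addrACA.
by [].
Qed.

(** * Cocycles vanishing on irreducible morphisms are inner *)

Section Restriction.
Variable c : M -> 'M[k]_(u, v).
Hypothesis cc : cocycle c.

Lemma cocycle_corner x : c (f ** x ** e) = c e *m T x + (c x + S x *m c f).
Proof. by rewrite cc (cc f) TM Tf Se !(mulmx1, mul1mx). Qed.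

(** [S] and [T] both kill [m], so only the term containing [c m] survives. This is the equivariance
    of the restriction of [c]. *)
Lemma cocycle_act g h m : e \notin ideal m -> f \notin ideal m ->
  c (g ** (m ** h)) = S h *m c m *m T g.
Proof.
move=> em fm; rewrite !cc SM (S0 em) (T0 fm).
by rewrite !(mulmx0, mul0mx, add0r, addr0).
Qed.

Hypothesis c0 : forall m, m \in IrrK e f -> c m = 0.

(** Here [c] takes the same value at [x] and [f ** x ** e]. If the latter is reducible, it is a
    product [p ** q] with [T p] and [S q] zero, and the cocycle identity gives zero. *)
Lemma cocycle_vanish x : e \notin ideal x -> f \notin ideal x -> c x = 0.
Proof.
move=> ex fx.
have -> : c x = c (f ** x ** e).
  by rewrite cocycle_corner (S0 ex) (T0 fx) mulmx0 mul0mx addr0 add0r.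
case: (boolP (f ** x ** e \in IrrK e f)) => [/c0 //|].
case/(reducibleP DG ie jf) => [||||p [q [-> eq fp]]].
- by rewrite !mmulA idemP.
- by rewrite -!mmulA idemP.
- by rewrite !ideal_mul // (negPf ex) andbF.
- by rewrite !ideal_mul // (negPf fx) andbF.
- by rewrite cc (T0 fp) (S0 eq) mulmx0 mul0mx addr0.
Qed.

Lemma cocycle_e0 : c e *m T e = 0.
Proof.
have := cc e e; rewrite idemP // Se mul1mx => H.
by apply: (@addIr _ (c e)); rewrite add0r -H.
Qed.

Lemma cocycle_f0 : S f *m c f = 0.
Proof.
have := cc f f; rewrite idemP // Tf mulmx1 => H.
by apply: (@addrI _ (c f)); rewrite addr0 -H.
Qed.

Hypothesis ne : e != f.

Let anti : e \in ideal f -> f \notin ideal e.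
Proof.
by move=> ef; apply: contra ne => fe; apply/eqP; apply: DG.2 => //; apply: eq_idealP.
Qed.

(** If [f] or [e] lies in the ideal of [x], it commutes with [x]; comparing [c] on the two products
    gives [c x = S f *m c x] or [c x = c x *m T e]. In each case one of these factors vanishes,
    since [e] and [f] generate different ideals. *)
Lemma normalized_cocycle0 x : c e = 0 -> c f = 0 -> c x = 0.
Proof.
move=> ce cf; case: (boolP (f \in ideal x)) => fx.
  have cx : c x = S f *m c x.
    have := congr1 c (ideal_comm DG jf fx).
    by rewrite !cc cf Tf mul0mx mulmx0 mulmx1 add0r addr0.
  case: (boolP (e \in ideal f)) => [ef|/S0 Sf]; last by rewrite cx Sf mul0mx.
  have := congr1 c (ideal_comm DG ie (ideal_trans ef fx)).
  by rewrite !cc ce Se (T0 (anti ef)) !(mul0mx, mulmx0) mul1mx !add0r.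
case: (boolP (e \in ideal x)) => ex; last exact: cocycle_vanish.
have := congr1 c (ideal_comm DG ie ex).
rewrite !cc ce Se (T0 (x := e)) ?(mul0mx, mulmx0) ?mul1mx ?add0r //.
by apply: contra fx => /ideal_trans; apply.
Qed.

End Restriction.

Lemma ideal_idem_one (a b : M) : idem a -> idem b -> a \in ideal b -> a ** b = a.
Proof.
move=> ia ib ab; rewrite -(ideal_comm DG ia ab).
by have [y [<- _]] := idealP DG _ ia ab; rewrite mmulA idemP.
Qed.

Lemma cocycle_inner_neq c : cocycle c -> (forall m, m \in IrrK e f -> c m = 0) ->
  e != f -> exists h : 'M[k]_(u, v), forall x, c x = S x *m h - h *m T x.
Proof.
move=> cc c0 ne.
have anti : e \in ideal f -> f \notin ideal e.
  by move=> ef; apply: contra ne => fe; apply/eqP; apply: DG.2 => //; apply: eq_idealP.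
(* The coboundary of [h] is [h] at [e] when [T e] is zero, and [- h] at [f] when [S f] is zero.
   Subtracting it kills one of the two values; the other then vanishes too. *)
pose h := if e \in ideal f then c e else - c f; exists h => x.
apply/eqP; rewrite -subr_eq0; apply/eqP.
pose c' x := c x - (S x *m h - h *m T x); rewrite -/(c' x).
have cc' : cocycle c' by apply: cocycleB => //; apply: coboundary_cocycle.
have c0' m : m \in IrrK e f -> c' m = 0.
  move=> Im; case/(irrP DG _ ie jf): (Im) => _ _ em fm _.
  by rewrite /c' c0 // (S0 em) (T0 fm) mul0mx mulmx0 !subrr.
have [ef|ef] := boolP (e \in ideal f).
  apply: normalized_cocycle0 => //.
    by rewrite /c' /h ef Se mul1mx (T0 (anti ef)) mulmx0 subr0 subrr.
  rewrite -[c' f]mul1mx -[RHS](cocycle_f0 cc'); congr (_ *m _).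
  by rewrite infl_one // ideal_idem_one.
have f0 : c' f = 0.
  by rewrite /c' /h (negPf ef) (S0 ef) Tf mul0mx mulmx1 sub0r opprK subrr.
apply: normalized_cocycle0 => //.
have [fe|fe] := boolP (f \in ideal e).
  rewrite -[c' e]mulmx1 -[RHS](cocycle_e0 cc'); congr (_ *m _).
  by rewrite infl_one // ideal_idem_one.
(* Neither ideal contains the other idempotent, so [c'] vanishes at [f ** e], where the cocycle
   identity leaves exactly [c' e]. *)
have := cocycle_vanish cc' c0' (x := f ** e); rewrite !ideal_mul // (negPf ef).
by rewrite (negPf fe) andbF => /(_ isT isT); rewrite cc' f0 mulmx0 addr0 Tf mulmx1.
Qed.

(** * Extending equivariant functions on irreducible morphisms to cocycles *)

Section Extension.
Variable phi : M -> 'M[k]_(u, v).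
Hypothesis phiE : forall g h m, g \in Ge f -> h \in Ge e -> m \in IrrK e f ->
  phi (g ** (m ** h)) = rhoU h *m phi m *m rhoV g.

Let phi0 m := if m \in IrrK e f then phi m else 0.
Let F x := phi0 (f ** x ** e).

Let phi0_act g h m : g \in Ge f -> h \in Ge e -> f ** m = m -> m ** e = m ->
  phi0 (g ** (m ** h)) = rhoU h *m phi0 m *m rhoV g.
Proof.
move=> Gg Gh fm me; rewrite /phi0.
have -> : (g ** (m ** h) \in IrrK e f) = (m \in IrrK e f).
  apply/idP/idP; last exact: Irr_act.
  move/(Irr_act DG ie jf (GeV DG jf Gg) (GeV DG ie Gh)).
  have [_ _ g'g] := ginvP Gg; have [_ hh' _] := ginvP Gh.
  by rewrite -!mmulA hh' me (mmulA (ginv f g)) g'g fm.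
by case: ifP => Im; rewrite ?mulmx0 ?mul0mx // phiE.
Qed.

Let F_left x y : f \in ideal x -> F (x ** y) = F y *m T x.
Proof.
move=> fx; rewrite /infl fx /F -[phi0 (f ** y ** e)]mul1mx -repU.1.
rewrite -phi0_act ?Ge1 ?Ge_corner //; last 2 first.
- by rewrite !mmulA idemP.
- by rewrite -!mmulA idemP.
congr phi0; rewrite -(mmulA _ e e) idemP // (ideal_comm DG jf fx) !mmulA idemP //.
by rewrite -(ideal_comm DG jf fx) -(mmulA x f f) idemP.
Qed.

Let F_right x y : e \in ideal y -> F (x ** y) = S y *m F x.
Proof.
move=> ey; rewrite /infl ey /F -[_ *m phi0 _]mulmx1 -repV.1.
rewrite -phi0_act ?Ge1 ?Ge_corner //; last 2 first.
- by rewrite !mmulA idemP.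
- by rewrite -!mmulA idemP.
congr phi0; rewrite !mmulA idemP // -(mmulA _ e e) idemP //.
by rewrite -(mmulA _ e y) -(ideal_comm DG ie ey) !mmulA -(mmulA _ e e) idemP.
Qed.

Let F_mid x y : f \notin ideal x -> e \notin ideal y -> F (x ** y) = 0.
Proof.
move=> fx ey; rewrite /F /phi0; case: ifP => // /(irrP DG _ ie jf)[_ _ _ _].
move=> /(_ (f ** x) (y ** e)); rewrite !ideal_mul // (negPf fx) (negPf ey) andbF.
by rewrite !mmulA => /(_ erefl) [].
Qed.

Lemma cocycle_extension : exists c, cocycle c /\
  forall m, m \in IrrK e f -> c m = phi m.
Proof.
(* When [f] lies in the ideal of [x] and [e] in that of [y], the terms [F y *m T x] and [S y *m F x]
   both equal [F (x ** y)]. The correction by [F (mone M)] removes this double count. *)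
exists (fun x => F x - S x *m F (mone M)); split=> [x y|m Im]; last first.
  case/(irrP DG _ ie jf): (Im) => fm me em _ _.
  by rewrite (S0 em) mul0mx subr0 /F /phi0 fm me Im.
rewrite SM mulmxBl mulmxBr !mulmxA [RHS]addrA; congr (_ - _).
have Fx : f \in ideal x -> F x = F (mone M) *m T x.
  by move=> fx; rewrite -{1}(mmulm1 x) F_left.
have Fy : e \in ideal y -> F y = S y *m F (mone M).
  by move=> fy; rewrite -{1}(mmul1 y) F_right.
case: (boolP (f \in ideal x)) => fx; case: (boolP (e \in ideal y)) => ey.
- by rewrite F_left // Fy // Fx // mulmxA subrr add0r.
- by rewrite F_left // (S0 ey) !mul0mx subr0 addr0.
- by rewrite F_right // (T0 fx) !mulmx0 subr0 add0r.
- by rewrite F_mid // (T0 fx) (S0 ey) !mulmx0 !mul0mx subr0 addr0.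
Qed.

End Extension.
End Cocycles.

Section SameObject.
Variables (M : fmonoid) (k : fieldType) (e : M) (u v : nat).
Variables (rhoU : M -> 'M[k]_u) (rhoV : M -> 'M[k]_v).
Hypotheses (DG : inDG M) (ie : idem e).
Hypotheses (repU : is_grep e rhoU) (repV : is_grep e rhoV).
Let N : k := (#|Ge e|)%:R.
Hypothesis nz : N != 0.

Local Notation S := (infl e rhoU).
Local Notation T := (infl e rhoV).

(** Averaging: [h0] is the sum of [S (ginv e y) *m c y] over the group, and translating the
    summation variable by [x] gives [S x *m h0 = h0 *m T x + N *: c x]. Then [N] is inverted, and
    general [x] reduces to [e ** x ** e] because [c e] is zero. *)
Lemma cocycle_inner_eq c : cocycle e e rhoU rhoV c ->
  (forall m, m \in IrrK e e -> c m = 0) ->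
  exists h, forall x, c x = S x *m h - h *m T x.
Proof.
move=> cc c0.
have SV g : g \in Ge e -> S (ginv e g) *m S g = 1%:M /\ S g *m S (ginv e g) = 1%:M.
  by move=> Gg; have [_ h1 h2] := ginvP Gg; rewrite -!infl_mul // h1 h2 infl_id.
pose h0 := \sum_(y in Ge e) S (ginv e y) *m c y.
have h0E x : x \in Ge e -> S x *m h0 = h0 *m T x + N *: c x.
  move=> Gx; have [_ xx' x'x] := ginvP Gx.
  have Gx' := GeV DG ie Gx.
  rewrite {1}/h0 (reindex_onto (mmul x) (mmul (ginv e x))) /=; last first.
    by move=> y /(GeP DG _ ie)[ey _ _]; rewrite mmulA xx'.
  have eqP y : (x ** y \in Ge e) && (ginv e x ** (x ** y) == y) = (y \in Ge e).
    apply/andP/idP => [[Gxy /eqP <-]|Gy]; first exact: GeM.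
    by rewrite mmulA x'x; case/(GeP DG _ ie): (Gy) => -> _ _; rewrite GeM.
  rewrite (eq_bigl _ _ eqP) mulmx_sumr.
  rewrite (eq_bigr (fun y => S (ginv e y) *m c y *m T x + c x)).
    by rewrite big_split /= -mulmx_suml sumr_const scaler_nat.
  move=> y Gy; rewrite (ginvM DG ie Gx Gy).
  rewrite infl_mul // cc !mulmxA (SV x Gx).2 mul1mx mulmxDr !mulmxA.
  by rewrite (SV y Gy).1 mul1mx.
exists (N^-1 *: h0) => x.
have ce : c e = 0.
  have := cocycle_e0 ie repU cc; rewrite infl_id // mulmx1; exact.
have cx : c (e ** x ** e) = c x.
  by rewrite (cocycle_corner DG ie ie repU repV cc) ce mul0mx mulmx0 add0r addr0.
case: (boolP (e \in ideal x)) => ex; last first.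
  by rewrite (cocycle_vanish DG ie ie repU repV cc c0) // !infl0 // mulmx0 mul0mx subr0.
have := h0E _ (Ge_corner DG ie ex); rewrite mmulA cx.
rewrite !infl_mul // !infl_id // !(mul1mx, mulmx1) -scalemxAl -scalemxAr => ->.
by rewrite scalerDr scalerA mulVf // scale1r addrC addKr.
Qed.

End SameObject.

Lemma cocycle_inner (M : fmonoid) (k : fieldType) (e f : M) u v
    (rhoU : M -> 'M[k]_u) (rhoV : M -> 'M[k]_v) c :
  inDG M -> char_not_dvd k M -> idem e -> idem f ->
  is_grep e rhoU -> is_grep f rhoV -> cocycle e f rhoU rhoV c ->
  (forall m, m \in IrrK e f -> c m = 0) ->
  exists h, forall x, c x = infl e rhoU x *m h - h *m infl f rhoV x.
Proof.
move=> DG nz ie jf repU repV cc c0; have [ef|ne] := eqVneq e f.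
  by subst f; apply: cocycle_inner_eq => //; apply: nz.
exact: cocycle_inner_neq.
Qed.

(** * Maximal subgroups and arrows *)

Section UnitGroup.
Variables (M : fmonoid) (DG : inDG M) (e : M) (ie : idem e).

(** The opposite of the maximal subgroup at e: representations in Defs act on
    row vectors and reverse products, those of mxrepresentation do not. *)
Definition units_op of inDG M & idem e : Type := {x : M | x \in Ge e}.
Local Notation G := (units_op DG ie).

HB.instance Definition _ := Finite.copy G {x : M | x \in Ge e}.

Definition units_mul (x y : G) : G :=
  exist _ (sval y ** sval x) (GeM DG ie (svalP y) (svalP x)).
Definition units_one : G := exist _ e (Ge1 DG ie).
Definition units_inv (x : G) : G := exist _ (ginv e (sval x)) (GeV DG ie (svalP x)).

Lemma units_mulA : associative units_mul.
Proof. by move=> x y z; apply: val_inj; rewrite /= mmulA. Qed.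

Lemma units_mul1 : left_id units_one units_mul.
Proof.
by case=> x Gx; apply: val_inj => /=; case/(GeP DG _ ie): (Gx).
Qed.

Lemma units_mulV : left_inverse units_one units_inv units_mul.
Proof. by case=> x Gx; apply: val_inj => /=; case: (ginvP Gx). Qed.

HB.instance Definition _ := Finite_isGroup.Build G units_mulA units_mul1 units_mulV.

Lemma card_units : #|{: G}| = #|Ge e|.
Proof. by rewrite card_sig; apply: eq_card => x; rewrite inE. Qed.

Section UnitRep.
Variables (k : fieldType) (n : nat) (rho : M -> 'M[k]_n).
Hypothesis rep : is_grep e rho.

Lemma units_reprP : mx_repr [set: G] (fun x : G => rho (sval x)).
Proof.
split; first exact: rep.1.
by move=> x y _ _; rewrite -rep.2 ?(svalP x) ?(svalP y).
Qed.

Definition units_repr := MxRepresentation units_reprP.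

Lemma units_abs_irr : irrep (Ge e) rho ->
  (forall A, (forall g, g \in Ge e -> A *m rho g = rho g *m A) ->
     exists c : k, A = c%:M) ->
  mx_absolutely_irreducible units_repr.
Proof.
move=> [n0 irr] spl; apply: cent_scalar_abs_irr.
  apply/mx_irrP; split=> // U /mxmoduleP modU nzU.
  case: (irr U) => [g Gg||//]; first exact: (modU (exist _ g Gg) (in_setT _)).
  by rewrite mxrank_eq0 (negPf nzU).
move=> A /centgmxP cA; apply/is_scalar_mxP/spl => g Gg.
exact: (cA (exist _ g Gg) (in_setT _)).
Qed.

End UnitRep.
End UnitGroup.

(** * Vectorizing Hom(U, V) as V tensor the dual of U *)

Section TensorVectors.
Variables (k : fieldType) (u v : nat).

(** The index order follows [*t] with the [V] factor first, so that [tvec_tens] turns the tensor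
    action into two-sided multiplication. *)
Definition tvec (A : 'M[k]_(u, v)) : 'rV[k]_(v * u) :=
  \row_j A (mxtens_unindex j).2 (mxtens_unindex j).1.

Definition untvec (w : 'rV[k]_(v * u)) : 'M[k]_(u, v) :=
  \matrix_(i, j) w 0 (mxtens_index (j, i)).

Lemma untvecK : cancel untvec tvec.
Proof. by move=> w; apply/rowP => j; rewrite !mxE -surjective_pairing mxtens_unindexK. Qed.

Lemma tvecK : cancel tvec untvec.
Proof. by move=> A; apply/matrixP => i j; rewrite !mxE mxtens_indexK. Qed.

Lemma tvec_tens A (B : 'M[k]_v) (C : 'M[k]_u) :
  tvec A *m (B *t C^T) = tvec (C *m A *m B).
Proof.
apply/rowP => j; case: (mxtens_indexP j) => j1 j2.
rewrite [LHS]mxE [RHS]mxE mxtens_indexK /= [RHS]mxE.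
rewrite (reindex (@mxtens_index v u)) /=; last first.
  by exists (@mxtens_unindex v u) => x _; rewrite ?mxtens_indexK ?mxtens_unindexK.
rewrite [RHS](eq_bigr (fun i1 => \sum_i2 C j2 i2 * A i2 i1 * B i1 j1)).
  rewrite pair_bigA /=; apply: eq_bigr => [[i1 i2] _].
  by rewrite tensmxE !mxE mxtens_indexK /= mulrA mulrAC [A _ _ * _]mulrC.
by move=> i1 _; rewrite mxE mulr_suml.
Qed.

End TensorVectors.

(** [ext1_dim] applies [linfun] to bare functions; here linearity is supplied as a proof. *)
Lemma linfunE (k : fieldType) (aT rT : vectType k) (h : aT -> rT) :
  linear h -> linfun h =1 h.
Proof.
move=> lin_h x.
pose hL : {linear aT -> rT} := HB.pack h (GRing.isLinear.Build _ _ _ _ h lin_h).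
exact: (lfunE hL x).
Qed.

(** * First extensions as intertwiners out of the permutation module *)

Section Arrows.
Variables (M : fmonoid) (k : fieldType) (e f : M) (u v : nat).
Variables (rhoU : M -> 'M[k]_u) (rhoV : M -> 'M[k]_v).
Hypotheses (DG : inDG M) (nz : char_not_dvd k M) (ie : idem e) (jf : idem f).
Hypotheses (repU : is_grep e rhoU) (repV : is_grep f rhoV).

Local Notation S := (infl e rhoU).
Local Notation T := (infl f rhoV).
Local Notation n := #|IrrK e f|.
Local Notation irr_val i := (@enum_val M (mem (IrrK e f)) i).
Local Notation P := (@perm_mod k M e f).
Local Notation X := (tens_dual e rhoV rhoU).

Lemma row_perm_mod g h (i j : 'I_n) d (F : 'M[k]_(n, d)) :
  irr_val j = g ** (irr_val i ** ginv e h) ->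
  row i (P (g, h) *m F) = row j F.
Proof.
move=> jE; apply/rowP => l; rewrite !mxE (bigD1 j) //= big1 => [|a aj].
  by rewrite mxE /= jE eqxx mul1r addr0.
by rewrite mxE /= -jE (inj_eq enum_val_inj) (negPf aj) mul0r.
Qed.

Lemma irr_val_act g h (i : 'I_n) : g \in Ge f -> h \in Ge e ->
  exists j : 'I_n, irr_val j = g ** (irr_val i ** ginv e h).
Proof.
move=> Gg Gh; have Ii : irr_val i \in IrrK e f := enum_valP i.
have Ij := Irr_act DG ie jf Gg (GeV DG ie Gh) Ii.
by exists (enum_rank_in Ii (g ** (irr_val i ** ginv e h))); rewrite enum_rankK_in.
Qed.

Definition restr_irr (c : {ffun M -> 'M[k]_(u, v)}) : 'M[k]_(n, v * u) :=
  \matrix_i tvec (c (irr_val i)).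

Lemma restr_irr_linear : linear restr_irr.
Proof.
by move=> a c d; apply/matrixP => i j; rewrite !mxE !ffunE !mxE.
Qed.

Lemma coboundary_linear : linear (coboundary S T).
Proof.
move=> a c d; apply/ffunP => x; rewrite !ffunE mulmxDr mulmxDl opprD addrACA.
by rewrite -scalemxAr -scalemxAl -scalerBr.
Qed.

Lemma cocycle_defect_linear : linear (cocycle_defect S T).
Proof.
move=> a c d; apply/ffunP => x; rewrite !ffunE !mulmxDl !mulmxDr.
rewrite -!scalemxAl -!scalemxAr addrACA -scalerDr opprD addrACA -scalerN -scalerDr.
by [].
Qed.

Definition cocycles : {vspace {ffun M -> 'M[k]_(u, v)}} :=
  lker (linfun (cocycle_defect S T)).

Lemma mem_cocycles c : c \in cocycles <-> cocycle e f rhoU rhoV c.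
Proof.
rewrite memv_ker linfunE; last exact: cocycle_defect_linear.
split=> [/eqP/ffunP H x y|H].
  by have := H (x, y); rewrite !ffunE /= => /eqP; rewrite subr_eq0 => /eqP.
by apply/eqP/ffunP => -[x y]; rewrite !ffunE /= H subrr.
Qed.

(** Taken as an image so that rank-nullity computes its dimension; [mem_homs] identifies it with the
    space of intertwiners. *)
Definition homs : {vspace 'M[k]_(n, v * u)} := (linfun restr_irr @: cocycles)%VS.

Lemma dim_homs : \dim homs = ext1_dim S T.
Proof.
rewrite /ext1_dim -/cocycles -(limg_ker_dim (linfun restr_irr) cocycles).
suff -> : (cocycles :&: lker (linfun restr_irr))%VS = limg (linfun (coboundary S T)).
  by rewrite addKn.
apply/vspaceP => c; rewrite memv_cap [X in _ && X]memv_ker linfunE; last exact: restr_irr_linear.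
apply/andP/memv_imgP => [[/mem_cocycles cc /eqP/row_matrixP c0]|[h _ ->]].
  have [|h hE] := @cocycle_inner _ _ _ _ _ _ _ _ _ DG nz ie jf repU repV cc.
    move=> m Im; have := c0 (enum_rank_in Im m).
    rewrite rowK enum_rankK_in // row0 => /(congr1 (@untvec _ _ _)).
    by rewrite tvecK => ->; apply/matrixP => i j; rewrite !mxE.
  exists h; rewrite ?memvf // linfunE; last exact: coboundary_linear.
  by apply/ffunP => x; rewrite ffunE -hE.
rewrite linfunE; last exact: coboundary_linear.
split.
  apply/mem_cocycles => x y; rewrite !ffunE.
  exact: (coboundary_cocycle DG ie jf repU repV h).
apply/eqP/row_matrixP => i; rewrite rowK ffunE row0.
have /(irrP DG _ ie jf)[_ _ em fm _] := enum_valP i.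
by rewrite infl0 // infl0 // mul0mx mulmx0 subrr; apply/rowP => j; rewrite !mxE.
Qed.

Lemma mem_homs F : F \in homs <->
  forall p, p \in GG f e -> P p *m F = F *m X p.
Proof.
split=> [/memv_imgP[c /mem_cocycles cc ->] [g h]|HF].
  rewrite inE => /andP[/= Gg Gh]; rewrite linfunE; last exact: restr_irr_linear.
  apply/row_matrixP => i; have [j jE] := irr_val_act i Gg Gh.
  rewrite (row_perm_mod _ jE) row_mul !rowK jE.
  have /(irrP DG _ ie jf)[_ _ em fm _] := enum_valP i.
  rewrite (cocycle_act DG ie repU cc) // tvec_tens.
  by rewrite !infl_Ge // GeV.
(* At most one index contributes: this reads the rows of [F] as a function on morphisms, zero off
   the irreducible ones. *)
pose phi m : 'M[k]_(u, v) := \sum_(i | irr_val i == m) untvec (row i F).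
have phiE i : phi (irr_val i) = untvec (row i F).
  by rewrite /phi (eq_bigl (pred1 i)) ?big_pred1_eq // => j; rewrite (inj_eq enum_val_inj).
have [|c [cc cphi]] := @cocycle_extension _ _ _ _ _ _ _ _ DG ie jf repU repV phi.
  move=> g h m Gg Gh Im; set i := enum_rank_in Im m.
  have iE : irr_val i = m by rewrite enum_rankK_in.
  have [j jE] := irr_val_act i Gg (GeV DG ie Gh).
  have h'h : ginv e (ginv e h) = h.
    by apply: ginvE; rewrite ?GeV //; case: (ginvP Gh).
  rewrite h'h iE in jE.
  (* The second component acts through its inverse, so right multiplication by [h] comes from
     [ginv e h]. *)
  have := HF (g, ginv e h); rewrite inE /= Gg GeV // => /(_ isT)/(congr1 (row i)).
  rewrite (@row_perm_mod g (ginv e h) i j); last by rewrite h'h iE.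
  rewrite row_mul -[row i F]untvecK tvec_tens /= h'h => /(congr1 (@untvec _ _ _)).
  by rewrite tvecK -!phiE jE iE.
apply/memv_imgP; exists (finfun c).
  by apply/mem_cocycles => x y; rewrite !ffunE cc.
rewrite linfunE; last exact: restr_irr_linear.
apply/row_matrixP => i; rewrite rowK ffunE cphi ?phiE ?untvecK //.
exact: enum_valP.
Qed.

End Arrows.

Lemma tensmx11 (R : pzRingType) m n : 1%:M *t 1%:M = 1%:M :> 'M[R]_(m * n).
Proof.
apply/matrixP => i j; case: (mxtens_indexP i) => i1 i2.
case: (mxtens_indexP j) => j1 j2; rewrite tensmxE !mxE.
by rewrite (can_eq (@mxtens_indexK _ _)) xpair_eqE -natrM mulnb.
Qed.

(** * The tensor and permutation modules as group representations *)

Section ArrowRepresentations.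
Variables (M : fmonoid) (k : fieldType) (e f : M) (u v : nat).
Variables (rhoU : M -> 'M[k]_u) (rhoV : M -> 'M[k]_v).
Hypotheses (DG : inDG M) (ie : idem e) (jf : idem f).
Hypotheses (repU : is_grep e rhoU) (repV : is_grep f rhoV).

Local Notation Gf' := (units_op DG jf).
Local Notation Ge' := (units_op DG ie).
Local Notation G := (setX_group [set: Gf']%G [set: Ge']%G).
Local Notation P := (@perm_mod k M e f).
Local Notation X := (tens_dual e rhoV rhoU).

Definition GG_val (p : Gf' * Ge') : M * M := (sval p.1, sval p.2).

Lemma GG_valP p : GG_val p \in GG f e.
Proof. by rewrite inE /= (svalP p.1) (svalP p.2). Qed.

Lemma GG_surj q : q \in GG f e -> exists2 p, p \in G & GG_val p = q.
Proof.
case: q => g h; rewrite inE /= => /andP[Gg Gh].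
by exists (exist _ g Gg, exist _ h Gh); rewrite ?inE.
Qed.

Lemma tens_reprP : mx_repr G (fun p => X (GG_val p)).
Proof.
split=> [|[g h] [g' h'] _ _]; rewrite /tens_dual /=.
  by rewrite (ginv_id DG ie) repU.1 repV.1 trmx1 tensmx11.
rewrite repV.2 ?(svalP g) ?(svalP g') //.
rewrite (ginvM DG ie) ?(svalP h) ?(svalP h') //.
by rewrite repU.2 ?(GeV DG) ?(svalP h) ?(svalP h') // trmx_mul tensmx_mul.
Qed.

Definition tens_repr := MxRepresentation tens_reprP.

Lemma perm_reprP : mx_repr G (fun p => P (GG_val p)).
Proof.
split=> [|[g h] [g' h'] _ _].
  apply/row_matrixP => i; rewrite -[X in row i X]mulmx1.
  rewrite (@row_perm_mod _ _ _ _ _ _ _ i) //= (ginv_id DG ie).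
  by have /(irrP DG _ ie jf)[fm me _ _ _] := enum_valP i; rewrite me fm.
apply/row_matrixP => i; rewrite -[X in row i X = _]mulmx1.
have [j jE] := irr_val_act DG ie jf i (svalP g) (svalP h).
have [l lE] := irr_val_act DG ie jf j (svalP g') (svalP h').
rewrite (row_perm_mod _ jE) -[P (GG_val (g', h'))]mulmx1 (row_perm_mod _ lE).
apply: row_perm_mod; rewrite /= (ginvM DG ie) ?(svalP h) ?(svalP h') //.
by rewrite lE jE !mmulA.
Qed.

Definition perm_repr := MxRepresentation perm_reprP.

Lemma card_GG_neq0 : char_not_dvd k M -> #|G|%:R != 0 :> k.
Proof. by move=> nz; rewrite cardsX !cardsT !card_units natrM mulf_neq0 ?nz. Qed.

Lemma mxmodule_stable U : mxmodule perm_repr U <-> stable (GG f e) P U.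
Proof.
split=> [/mxmoduleP modU q /GG_surj[p Gp <-]|stU]; first exact: modU.
by apply/mxmoduleP => p _; apply/stU/GG_valP.
Qed.

Lemma mxsimple_irr_submod U : mxsimple perm_repr U -> irr_submod (GG f e) P U.
Proof.
case=> /mxmodule_stable stU nzU minU; split=> //; split; rewrite ?mxrank_eq0 //.
move=> V /mxmodule_stable modV sVU; rewrite mxrank_eq0.
by have [|nzV] := eqVneq V 0; [left | right; rewrite sVU minU].
Qed.

Lemma embeds_submod_iso r (W : 'I_r -> 'M[k]__) i :
  (exists phi, embeds_onto perm_repr tens_repr W i phi) <->
  submod_iso (GG f e) X P (W i).
Proof.
split=> -[phi [free im com]]; exists phi; split=> //.
  by move=> q /GG_surj[p Gp <-]; apply: com.
by move=> p _; apply/com/GG_valP.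
Qed.

End ArrowRepresentations.

(** Maschke decomposes the permutation module. By [dim_hom] the summands isomorphic to the tensor
    module number the dimension of [homs], which is that of the Ext space by [dim_homs]. *)
Lemma arrows_multiplicity (M : fmonoid) (k : fieldType) (e f : M) u v
    (rhoU : M -> 'M[k]_u) (rhoV : M -> 'M[k]_v) :
  inDG M -> splitting_field k M -> char_not_dvd k M ->
  idem e -> is_grep e rhoU -> irrep (Ge e) rhoU ->
  idem f -> is_grep f rhoV -> irrep (Ge f) rhoV ->
  multiplicity (GG f e) (tens_dual e rhoV rhoU) (perm_mod k e f)
    (ext1_dim (infl e rhoU) (infl f rhoV)).
Proof.
move=> DG spl nz ie repU irrU jf repV irrV.
have absU := units_abs_irr DG ie repU irrU (spl _ _ _ ie repU irrU).
have absV := units_abs_irr DG jf repV irrV (spl _ _ _ jf repV irrV).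
have absX : mx_absolutely_irreducible (tens_repr DG ie jf repU repV).
  by apply: tens_abs_irr absV absU _ => -[g Gg] [h Gh] _ _.
have [r [W [simW defW dxW]]] :=
  semisimple_of_pchar (perm_repr k DG ie jf) (card_GG_neq0 DG ie jf nz).
exists r, W; split.
- by move=> i; apply: mxsimple_irr_submod.
- by rewrite -[RHS](mxrank1 k) -defW (mxdirectP dxW).
- by rewrite defW.
(* Isomorphism is a proposition, so excluded middle turns it into a finite set of indices. *)
pose S := [set i | if excluded_middle_informative
  (submod_iso (GG f e) (tens_dual e rhoV rhoU) (perm_mod k e f) (W i))
  then true else false].
have SP i : i \in S <->
    submod_iso (GG f e) (tens_dual e rhoV rhoU) (perm_mod k e f) (W i).
  by rewrite inE; case: excluded_middle_informative.
exists S => //; rewrite -(dim_homs DG nz ie jf repU repV).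
symmetry; apply: (dim_hom (rP := perm_repr k DG ie jf)
   (rX := tens_repr DG ie jf repU repV) simW defW dxW).
- exact: mx_abs_irrW.
- exact: mx_abs_irr_cent_scalar.
- move=> F; split=> [/(mem_homs DG ie jf repU repV) HF p _|HF].
    exact/HF/GG_valP.
  apply/(mem_homs DG ie jf repU repV) => q /(GG_surj DG ie jf)[p Gp <-].
  exact: HF.
- by move=> i; apply: iff_trans (SP i) (iff_sym (embeds_submod_iso _ _ _ _ _ _ _)).
Qed.

Theorem mainTheorem5 (M : fmonoid) (k : fieldType) :
  inDG M -> splitting_field k M -> char_not_dvd k M ->
  (* vertices: the simple kM-modules are exactly the inflations of the
     simple kG_e-modules, e in E(M), pairwise non-isomorphic *)
  (forall (e : M) n (rho : M -> 'M[k]_n),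
     idem e -> is_grep e rho -> irrep (Ge e) rho ->
     is_mrep (infl e rho) /\ irrep [set: M] (infl e rho)) /\
  (forall n (rho : M -> 'M[k]_n), is_mrep rho -> irrep [set: M] rho ->
     exists (e : M) (n' : nat) (rho' : M -> 'M[k]_n'),
       [/\ idem e, is_grep e rho', irrep (Ge e) rho' &
           rep_iso [set: M] rho (infl e rho')]) /\
  (forall (e f : M) n1 n2 (rho1 : M -> 'M[k]_n1) (rho2 : M -> 'M[k]_n2),
     idem e -> is_grep e rho1 -> irrep (Ge e) rho1 ->
     idem f -> is_grep f rho2 -> irrep (Ge f) rho2 ->
     (rep_iso [set: M] (infl e rho1) (infl f rho2) <->
      e = f /\ rep_iso (Ge e) rho1 rho2)) /\
  (* arrows: #arrows U -> V = dim Ext^1(U, V) = multiplicity of V (x) U^*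
     in k[Irr_{K(M)}(e,f)] *)
  (forall (e f : M) u v (rhoU : M -> 'M[k]_u) (rhoV : M -> 'M[k]_v),
     idem e -> is_grep e rhoU -> irrep (Ge e) rhoU ->
     idem f -> is_grep f rhoV -> irrep (Ge f) rhoV ->
     multiplicity (GG f e) (tens_dual e rhoV rhoU) (perm_mod k e f)
       (ext1_dim (infl e rhoU) (infl f rhoV))).
Proof.
move=> DG spl nz; split; first by move=> e n rho ie rep irr; split;
  [apply: infl_mrep | apply: infl_irrep].
split.
  move=> n rho rep irr; have [e [ie rhoE grep girr]] := simple_is_inflation DG rep irr.
  exists e, n, rho; split=> //; exists 1%:M; split; rewrite ?row_free_unit
    ?row_full_unit ?unitmx1 //.
  by move=> x _; rewrite mulmx1 mul1mx.
split; first by move=> *; apply: infl_iso.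
by move=> *; apply: arrows_multiplicity.
Qed.
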